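(* Let $\mathbf{m}\in\mathbb{R}^d\setminus\{0\}$, $c\in(0,1]$, and $0<R<c\|\mathbf{m}\|_2$. If $d\ge2$, then $$\min\Bigl\{\alpha>0:\langle\alpha\mathbf{m},\mathbf{y}\rangle\ge\langle\mathbf{x},\mathbf{y}\rangle,\ \forall\mathbf{x}\in\mathbb{B}(\mathbf{m},R),\ \forall\mathbf{y}\in\mathcal{C}(\mathbf{x},c)\Bigr\}=\frac{c\bigl(\|\mathbf{m}\|_2^2-R^2\bigr)}{\|\mathbf{m}\|_2\bigl(c\|\mathbf{m}\|_2-R\bigr)}$$ (in particular the minimum is attained). If $d=1$, the minimum on the left-hand side equals $1+R/\|\mathbf{m}\|_2$, and the right-hand side above remains a valid upper bound for it.
   Context: $\mathbb{B}(\mathbf{m},R):=\{\mathbf{x}\in\mathbb{R}^d:\|\mathbf{x}-\mathbf{m}\|_2\le R\}$. For $\mathbf{x}\ne0$ and $c\in(0,1]$, $\mathcal{C}(\mathbf{x},c):=\{\mathbf{y}\in\mathbb{R}^d:\langle\mathbf{x},\mathbf{y}\rangle\ge c\|\mathbf{x}\|_2\|\mathbf{y}\|_2\}$. Since $R<\|\mathbf{m}\|_2$, the ball does not contain the origin. *)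

(* Defs.v *)
From mathcomp Require Import all_boot all_order all_algebra.
From mathcomp Require Import classical_sets reals.

Set Implicit Arguments.
Unset Strict Implicit.
Unset Printing Implicit Defensive.

Import Order.TTheory GRing.Theory Num.Theory.
Local Open Scope classical_set_scope.
Local Open Scope ring_scope.

Definition dot (R : realType) (d : nat) (u v : 'rV[R]_d) : R :=
  \sum_(i < d) u 0 i * v 0 i.

(* The norm that MathComp-Analysis puts on 'rV[R]_d is the sup norm, hence a
   separate Euclidean norm. *)
Definition norm2 (R : realType) (d : nat) (u : 'rV[R]_d) : R :=
  Num.sqrt (dot u u).

Definition closed_ball2 (R : realType) (d : nat) (m : 'rV[R]_d) (r : R) :
    set 'rV[R]_d :=
  [set x | norm2 (x - m) <= r].

(* Meant for x != 0 and 0 < c <= 1; it is the whole space when x = 0. *)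
Definition cone (R : realType) (d : nat) (x : 'rV[R]_d) (c : R) :
    set 'rV[R]_d :=
  [set y | dot x y >= c * norm2 x * norm2 y].

Definition dominating_scalings (R : realType) (d : nat) (m : 'rV[R]_d)
    (r c : R) : set R :=
  [set a | 0 < a /\
    forall x, closed_ball2 m r x ->
    forall y, cone x c y -> dot (a *: m) y >= dot x y].

Definition is_minimum (R : realType) (A : set R) (a : R) : Prop :=
  A a /\ lbound A a.

(* Main.v *)
(** For a fixed [x], the cone of the vectors at cosine at least [c] to [x] is dual
    to the one at cosine at least [sqrt (1 - c ^+ 2)]. Hence [a] is a dominating
    scaling iff [a *: m - x] lies in the dual of [cone x c] for all [x] in the
    ball. With [M = norm2 m], [D = M ^+ 2 - r ^+ 2] and
    [N = M ^+ 2 + r ^+ 2 - 2 c M r], this condition at the claimed optimum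
    follows, for [X = dot x x], from [(N * X - D ^+ 2) ^+ 2 >= 0].
    It is tight at [x = (D / N) (M - c r, s r)], [y = (c M - r, s M)] in an
    orthonormal frame whose first vector is [m / M], where
    [s = sqrt (1 - c ^+ 2)]; such a frame needs dimension at least 2. *)
Require Import Defs.
From mathcomp Require Import all_boot all_order all_algebra.
From mathcomp Require Import classical_sets reals.
From mathcomp Require Import ring lra.

Import Order.TTheory GRing.Theory Num.Theory.
Local Open Scope classical_set_scope.
Local Open Scope ring_scope.

(** * Euclidean geometry: dot product, cones and their duality *)

Section Dot.
Context {R : realType} {d : nat}.
Implicit Types (u v w x y : 'rV[R]_d) (a c : R).

Lemma dotC u v : dot u v = dot v u.
Proof. by apply: eq_bigr => i _; rewrite mulrC. Qed.

Lemma dotDl u v w : dot (u + v) w = dot u w + dot v w.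
Proof. by rewrite -big_split; apply: eq_bigr => i _; rewrite mxE mulrDl. Qed.

Lemma dotZl a u v : dot (a *: u) v = a * dot u v.
Proof. by rewrite mulr_sumr; apply: eq_bigr => i _; rewrite mxE mulrA. Qed.

Lemma dotBl u v w : dot (u - v) w = dot u w - dot v w.
Proof. by rewrite -scaleN1r dotDl dotZl mulN1r. Qed.

Lemma dotDr u v w : dot u (v + w) = dot u v + dot u w.
Proof. by rewrite dotC dotDl !(dotC u). Qed.

Lemma dotZr a u v : dot u (a *: v) = a * dot u v.
Proof. by rewrite dotC dotZl dotC. Qed.

Lemma dotBr u v w : dot u (v - w) = dot u v - dot u w.
Proof. by rewrite dotC dotBl !(dotC u). Qed.

Lemma dot_ge0 u : 0 <= dot u u.
Proof. by apply: sumr_ge0 => i _; rewrite -expr2 sqr_ge0. Qed.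

Lemma dot_eq0 u : (dot u u == 0) = (u == 0).
Proof.
apply/eqP/eqP => [/psumr_eq0P u0|->]; last first.
  by rewrite /dot big1 // => i _; rewrite mxE mul0r.
apply/rowP => i; rewrite mxE; apply/eqP; rewrite -sqrf_eq0 expr2 u0 //.
by move=> j _; rewrite -expr2 sqr_ge0.
Qed.

Lemma dot_gt0 u : u != 0 -> 0 < dot u u.
Proof. by move=> u0; rewrite lt_neqAle eq_sym dot_eq0 u0 dot_ge0. Qed.

Lemma norm2_ge0 u : 0 <= norm2 u.
Proof. exact: sqrtr_ge0. Qed.

Lemma norm2_gt0 u : u != 0 -> 0 < norm2 u.
Proof. by move=> u0; rewrite sqrtr_gt0 dot_gt0. Qed.

Lemma sqr_norm2 u : norm2 u ^+ 2 = dot u u.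
Proof. by rewrite sqr_sqrtr // dot_ge0. Qed.

Lemma norm2_le u a : 0 <= a -> (norm2 u <= a) = (dot u u <= a ^+ 2).
Proof. by move=> a0; rewrite -sqr_norm2 ler_sqr ?nnegrE ?norm2_ge0. Qed.

Lemma dot_Cauchy_Schwarz u v : dot u v ^+ 2 <= dot u u * dot v v.
Proof.
have [->|u0] := eqVneq u 0.
  by rewrite -(scale0r (0 : 'rV_d)) !dotZl !mul0r expr0n.
(* This squared norm is [dot u u] times the difference of the two sides. *)
have := dot_ge0 (dot u u *: v - dot u v *: u).
rewrite !(dotBl, dotBr, dotZl, dotZr) (dotC v u) => h.
rewrite -subr_ge0 -(pmulr_rge0 _ (dot_gt0 u u0)); lra.
Qed.

Lemma dot_le_norm2 u v : dot u v <= norm2 u * norm2 v.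
Proof.
apply: le_trans (ler_norm _) _.
rewrite -ler_sqr ?nnegrE ?mulr_ge0 ?norm2_ge0 ?normr_ge0 //.
by rewrite real_normK ?num_real // exprMn !sqr_norm2 dot_Cauchy_Schwarz.
Qed.

(** Squaring removes the square roots, so the sign of [dot x y] has to be kept as a separate
    condition. *)
Lemma coneP x y c : 0 <= c ->
  cone x c y <-> 0 <= dot x y /\ c ^+ 2 * (dot x x * dot y y) <= dot x y ^+ 2.
Proof.
move=> c0; rewrite /cone /= -!sqr_norm2 -!exprMn mulrA.
have h0 : 0 <= c * norm2 x * norm2 y by rewrite !mulr_ge0 ?norm2_ge0.
split=> [h|[a0]]; last by rewrite ler_sqr.
by split; [exact: le_trans h|rewrite ler_sqr // nnegrE (le_trans h0)].
Qed.

(** The angles that [y] and [v] make with [x] add up to at most a right angle. Cauchy-Schwarz on the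
    components orthogonal to [x], scaled by [X] to avoid division, gives this without angles:
    [X * g] differs from [a * b] by at most [a * b]. *)
Lemma cone_dual x y v c : x != 0 -> 0 <= c <= 1 -> cone x c y ->
  0 <= dot x v -> (1 - c ^+ 2) * (dot x x * dot v v) <= dot x v ^+ 2 ->
  0 <= dot v y.
Proof.
move=> x0 /andP[c0 c1] /(coneP _ _ _ c0)[].
have X0 := dot_gt0 x x0.
have := dot_ge0 y; have := dot_ge0 v.
set X := dot x x in X0 *; set a := dot x y; set b := dot x v.
set Y := dot y y; set V := dot v v; set g := dot v y.
move=> V0 Y0 a0 ha b0 hb.
have CS := dot_Cauchy_Schwarz (X *: v - b *: x) (X *: y - a *: x).
have {}CS : (X * g - a * b) ^+ 2 <= (X * V - b ^+ 2) * (X * Y - a ^+ 2).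
  rewrite -(ler_pM2l (exprn_gt0 2 X0)).
  move: CS; rewrite !(dotBl, dotBr, dotZl, dotZr) (dotC v x) (dotC y x).
  rewrite -/X -/Y -/V -/a -/b -/g; lra.
have c2 : c ^+ 2 <= 1 by rewrite expr_le1.
have hV : X * V - b ^+ 2 <= c ^+ 2 * (X * V) by lra.
have hY : X * Y - a ^+ 2 <= (1 - c ^+ 2) * (X * Y) by lra.
have hY0 : 0 <= X * Y - a ^+ 2.
  by rewrite subr_ge0 /a /X /Y dot_Cauchy_Schwarz.
have hV0 : 0 <= X * V - b ^+ 2.
  by rewrite subr_ge0 /b /X /V dot_Cauchy_Schwarz.
have h1 := ler_pM hV0 hY0 hV hY.
have h2 : (c ^+ 2 * (X * Y)) * ((1 - c ^+ 2) * (X * V)) <= a ^+ 2 * b ^+ 2.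
  by apply: ler_pM => //; rewrite !mulr_ge0 ?sqr_ge0 ?subr_ge0 // ltW.
have h3 : (X * g - a * b) ^+ 2 <= (a * b) ^+ 2 by lra.
rewrite -(pmulr_rge0 _ X0).
have ab0 : 0 <= a * b by exact: mulr_ge0.
have /ler_normlP[] : `|X * g - a * b| <= a * b.
  by rewrite -ler_sqr ?nnegrE // real_normK ?num_real.
lra.
Qed.

Lemma exists_orthonormal u : (2 <= d)%N ->
  exists e, dot e e = 1 /\ dot u e = 0.
Proof.
move=> d2.
(* In the plane of the first two coordinates, take the second basis vector if it is orthogonal to
   [u], and otherwise a quarter turn of the projection of [u]. *)
have [w w0 uw] : exists2 w, w != 0 & dot u w = 0.
  pose i : 'I_d := Ordinal (ltnW d2); pose j : 'I_d := Ordinal d2.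
  have dot_delta v k : dot v (delta_mx 0 k) = v 0 k.
    rewrite /dot (bigD1 k) //= mxE !eqxx mulr1 big1 ?addr0 // => l /negPf lk.
    by rewrite mxE lk andbF mulr0.
  have [uj|uj] := eqVneq (u 0 j) 0.
    exists (delta_mx 0 j); last by rewrite dot_delta.
    by rewrite -dot_eq0 dot_delta mxE !eqxx oner_eq0.
  exists (u 0 j *: delta_mx 0 i - u 0 i *: delta_mx 0 j).
    apply: contraNneq uj => /(congr1 (fun v : 'rV_d => v 0 i)).
    by rewrite !mxE /= mulr1 mulr0 subr0 => ->.
  by rewrite dotBr !dotZr !dot_delta mulrC subrr.
exists ((norm2 w)^-1 *: w); rewrite (dotZr _ u) uw mulr0; split=> //.
by rewrite dotZl dotZr -sqr_norm2; field; rewrite gt_eqF // norm2_gt0.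
Qed.

End Dot.

(** * The ball and the optimal scaling *)

Section Ball.
Context {R : realType} {d : nat}.
Variables (m : 'rV[R]_d) (c r : R).
Hypotheses (hm : m != 0) (hc0 : 0 < c) (hc1 : c <= 1).
Hypotheses (hr0 : 0 < r) (hr : r < c * norm2 m).

Local Notation M := (norm2 m).
Let alpha := c * (M ^+ 2 - r ^+ 2) / (M * (c * M - r)).

Let M0 : 0 < M := norm2_gt0 m hm.

Lemma radius_lt_norm2 : r < M.
Proof. by apply: lt_le_trans hr _; rewrite ler_piMl // ltW. Qed.
Let rM := radius_lt_norm2.

(** After clearing denominators the two sides differ by [(1 - c) * r * (M + r)]. Beyond dimension
    one, this also yields [alpha > 0] and [M + r <= alpha * M]. *)
Lemma alpha_ge : 1 + r / M <= alpha.
Proof.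
have K0 : 0 < c * M - r by rewrite subr_gt0.
rewrite /alpha ler_pdivlMr ?mulr_gt0 //.
have -> : (1 + r / M) * (M * (c * M - r)) = (M + r) * (c * M - r).
  by field; rewrite gt_eqF.
have : 0 <= (M + r) * ((1 - c) * r).
  by rewrite !mulr_ge0 ?subr_ge0 ?addr_ge0 // ltW.
lra.
Qed.

Lemma closed_ball2_dot x : closed_ball2 m r x ->
  dot x x + (M ^+ 2 - r ^+ 2) <= 2 * dot m x.
Proof.
rewrite /closed_ball2 /= norm2_le ?(ltW hr0) // !(dotBl, dotBr) (dotC x m).
rewrite -(sqr_norm2 m); lra.
Qed.

(** Cauchy-Schwarz turns the expanded ball condition into [(n - M) ^+ 2 <= r ^+ 2]. *)
Lemma closed_ball2_norm2 x : closed_ball2 m r x -> norm2 x <= M + r.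
Proof.
move=> /closed_ball2_dot; rewrite -sqr_norm2.
have := dot_le_norm2 m x; set n := norm2 x => h1 h2.
have : (n - M) ^+ 2 <= r ^+ 2 by lra.
rewrite -[in X in X -> _]real_normK ?num_real // ler_sqr ?nnegrE ?normr_ge0
  ?(ltW hr0) //.
by move=> /ler_normlP[]; lra.
Qed.

Lemma closed_ball2_neq0 x : closed_ball2 m r x -> x != 0.
Proof.
move=> /closed_ball2_dot h; apply/eqP => x0; move: h; rewrite x0.
rewrite -(scale0r (0 : 'rV_d)) !(dotZl, dotZr) !mul0r mulr0 add0r.
have : r ^+ 2 < M ^+ 2 by rewrite ltr_sqr ?nnegrE ?ltW.
lra.
Qed.

Lemma alpha_gt0 : 0 < alpha.
Proof.
by apply: lt_le_trans alpha_ge; rewrite addr_gt0 // divr_gt0.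
Qed.

Lemma alpha_dominating : dominating_scalings m r c alpha.
Proof.
split=> [|x xB y yC]; first exact: alpha_gt0.
have a0 := alpha_gt0.
have x0 := closed_ball2_neq0 x xB.
have X0 := dot_gt0 x x0.
have hq := closed_ball2_dot x xB.
have hn := closed_ball2_norm2 x xB.
have ha := alpha_ge.
have K0 : 0 < c * M - r by rewrite subr_gt0.
rewrite -subr_ge0 -dotBl.
set X := dot x x in X0 hq *; set q := dot m x in hq *.
set D := M ^+ 2 - r ^+ 2 in hq.
have D0 : 0 < D by rewrite subr_gt0 ltr_sqr ?nnegrE ?ltW.
have hX : X <= (M + r) ^+ 2.
  by rewrite /X -norm2_le // addr_ge0 ?ltW.
have hM : M + r <= alpha * M.
  by rewrite -ler_pdivrMr // mulrDl divff ?gt_eqF.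
(* Needed to compare squares in [h1]. Since [D = (M - r) * (M + r)], the gap times [M] is at least
   [(M - r) * ((M + r) ^+ 2 - X)]. *)
have hq0 : 2 * X <= alpha * (X + D).
  have h1 : 0 <= (alpha * M - (M + r)) * (X + D).
    by rewrite mulr_ge0 ?subr_ge0 ?(ltW (addr_gt0 X0 D0)).
  have h2 : 0 <= ((M + r) ^+ 2 - X) * (M - r).
    by rewrite mulr_ge0 ?subr_ge0 // ltW.
  rewrite -subr_ge0 -(pmulr_rge0 _ M0).
  rewrite /D in h1 *; lra.
have hq1 : alpha * (X + D) <= alpha * (2 * q) by rewrite ler_pM2l.
apply: (@cone_dual _ _ x _ _ c) => //; first by rewrite (ltW hc0).
  rewrite dotBr dotZr (dotC x m) -/X -/q; lra.
rewrite !(dotBl, dotBr, dotZl, dotZr) (dotC x m) -/X -/q -(sqr_norm2 m).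
(* The dual cone condition with [q] lowered to [(X + D) / 2], its value on the bounding sphere. [h1]
   and [h2] return to the actual [q]: raising it increases the square and shortens
   [alpha *: m - x]. *)
have key : 0 <= (alpha * (X + D) / 2 - X) ^+ 2 -
    (1 - c ^+ 2) * X * (alpha ^+ 2 * M ^+ 2 - alpha * (X + D) + X).
  have -> : (alpha * (X + D) / 2 - X) ^+ 2 -
      (1 - c ^+ 2) * X * (alpha ^+ 2 * M ^+ 2 - alpha * (X + D) + X) =
      (c * ((M ^+ 2 + r ^+ 2 - 2 * c * M * r) * X - D ^+ 2) /
       (2 * M * (c * M - r))) ^+ 2.
    by rewrite /alpha /D; field; rewrite !gt_eqF.
  exact: sqr_ge0.
have h1 : (alpha * (X + D) / 2 - X) ^+ 2 <= (alpha * q - X) ^+ 2.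
  by rewrite ler_sqr ?nnegrE; lra.
have h2 : 0 <= (1 - c ^+ 2) * X * (alpha * (2 * q) - alpha * (X + D)).
  by rewrite !mulr_ge0 ?subr_ge0 ?expr_le1 // ltW.
lra.
Qed.

Lemma alpha_lbound : (2 <= d)%N -> lbound (dominating_scalings m r c) alpha.
Proof.
move=> /(exists_orthonormal m)[e [ee me]] a [a0 adom].
have K0 : 0 < c * M - r by rewrite subr_gt0.
pose s := Num.sqrt (1 - c ^+ 2).
have s2 : s ^+ 2 = 1 - c ^+ 2 by rewrite sqr_sqrtr // subr_ge0 expr_le1 // ltW.
pose D := M ^+ 2 - r ^+ 2; pose N := M ^+ 2 + r ^+ 2 - 2 * c * M * r.
have D0 : 0 < D by rewrite subr_gt0 ltr_sqr ?nnegrE ?ltW.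
have N0 : 0 < N.
  have : 0 < (M - r) ^+ 2 by rewrite exprn_gt0 ?subr_gt0.
  have : 0 <= (1 - c) * (M * r) by rewrite !mulr_ge0 ?subr_ge0 // ltW.
  rewrite /N; lra.
(* Before scaling by [D / N], this vector lies on the sphere of radius [r] about [m] and has squared
   norm [N]. As [D] is the power of the origin, the scaling moves it to the other point where its
   ray meets the sphere. The vector [y] is on the boundary of the cone of [x]. *)
pose x := (D / N) *: ((1 - c * r / M) *: m + (s * r) *: e).
pose y := ((c * M - r) / M) *: m + (s * M) *: e.
have mm : dot m m = M ^+ 2 by rewrite sqr_norm2.
have dotE (k l k' l' : R) : dot (k *: m + l *: e) (k' *: m + l' *: e) =
    k * k' * M ^+ 2 + l * l'.
  by rewrite !(dotDl, dotDr, dotZl, dotZr) (dotC e m) me ee mm; ring.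
have MN : M != 0 by rewrite gt_eqF.
have NN : N != 0 by rewrite gt_eqF.
have xx : dot x x = D ^+ 2 / N.
  rewrite /x !(dotZl, dotZr) dotE.
  have -> : s * r * (s * r) = (1 - c ^+ 2) * r ^+ 2 by rewrite -s2; ring.
  by move: NN; rewrite /N => NN; field; rewrite NN.
have yy : dot y y = N.
  rewrite /y dotE.
  have -> : s * M * (s * M) = (1 - c ^+ 2) * M ^+ 2 by rewrite -s2; ring.
  by rewrite /N; field.
have xy : dot x y = c * D.
  rewrite /x /y !(dotZl, dotZr) dotE.
  have -> : s * r * (s * M) = (1 - c ^+ 2) * (r * M) by rewrite -s2; ring.
  by move: NN; rewrite /N => NN; field; rewrite MN NN.
have xm : dot x m = D / N * (M * (M - c * r)).
  by rewrite /x !(dotDl, dotZl) (dotC e m) me mm; field; rewrite MN NN.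
have my : dot m y = M * (c * M - r) by rewrite /y !(dotDr, dotZr) me mm; field.
have xB : closed_ball2 m r x.
  rewrite /closed_ball2 /= norm2_le ?(ltW hr0) // !(dotBl, dotBr) (dotC m x).
  rewrite xx xm mm.
  rewrite le_eqVlt; apply/orP; left; apply/eqP.
  by move: NN; rewrite /D /N => NN; field.
have yC : cone x c y.
  apply/(coneP _ _ _ (ltW hc0)); rewrite xx xy yy divfK // exprMn; split=> //.
  by rewrite mulr_ge0 ?ltW.
(* On this pair domination reads [c * D <= a * (M * (c * M - r))], that is, [alpha <= a]. *)
have := adom x xB y yC; rewrite (dotZl a m) my xy => h.
by rewrite /alpha ler_pdivrMr ?mulr_gt0.
Qed.

End Ball.

(** * The one-dimensional case *)

Lemma dim1_is_minimum (R : realType) (m : 'rV[R]_1) (c r : R) :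
  m != 0 -> 0 < c -> c <= 1 -> 0 < r -> r < c * norm2 m ->
  is_minimum (dominating_scalings m r c) (1 + r / norm2 m).
Proof.
move=> hm hc0 hc1 hr0 hr.
have M0 := norm2_gt0 m hm.
have rM := radius_lt_norm2 m c r hm hc1 hr.
have mm := sqr_norm2 m.
set M := norm2 m in M0 rM mm *.
split; first split.
- by rewrite addr_gt0 ?divr_gt0.
- move=> x xB y /(coneP _ _ _ (ltW hc0))[t0 _].
  have hq := closed_ball2_dot m r hr0 x xB.
  have hn := closed_ball2_norm2 m r hr0 x xB.
  have hCS := dot_le_norm2 m x.
  (* All vectors are multiples of [m], so [dot x y] and [dot m x] determine the sign of
     [dot m y]. *)
  have tp : dot x y * M ^+ 2 = dot m y * dot m x.
    by rewrite mm /dot !big_ord1; ring.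
  have D0 : 0 < M ^+ 2 - r ^+ 2 by rewrite subr_gt0 ltr_sqr ?nnegrE ?ltW.
  have q0 : 0 < dot m x by move: (dot_ge0 x) hq; rewrite -/M; lra.
  have p0 : 0 <= dot m y.
    by rewrite -(pmulr_lge0 _ q0) -tp mulr_ge0 ?sqr_ge0.
  rewrite dotZl -(ler_pM2r (exprn_gt0 2 M0)) tp.
  have -> : (1 + r / M) * dot m y * M ^+ 2 = dot m y * (M * (M + r)).
    by field; rewrite gt_eqF.
  by rewrite ler_wpM2l // (le_trans hCS) // ler_wpM2l // ltW.
- move=> a [a0 adom].
  (* The point of the ball farthest from the origin, tested against [m] itself, forces the bound. *)
  have xB : closed_ball2 m r ((1 + r / M) *: m).
    rewrite /closed_ball2 /= norm2_le ?(ltW hr0) // scalerDl scale1r addrC addKr.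
    rewrite dotZl dotZr -mm le_eqVlt; apply/orP; left; apply/eqP.
    by field; rewrite gt_eqF.
  have yC : cone ((1 + r / M) *: m) c m.
    apply/(coneP _ _ _ (ltW hc0)); rewrite !(dotZl, dotZr) -mm.
    have k0 : 0 < 1 + r / M by rewrite addr_gt0 ?divr_gt0.
    split; first by rewrite mulr_ge0 ?sqr_ge0 ?ltW.
    have -> : c ^+ 2 * ((1 + r / M) * ((1 + r / M) * M ^+ 2) * M ^+ 2) =
      c ^+ 2 * ((1 + r / M) * M ^+ 2) ^+ 2 by ring.
    by rewrite ler_piMl ?sqr_ge0 // expr_le1 // ltW.
  have := adom _ xB _ yC.
  by rewrite !dotZl -mm ler_pM2r // exprn_gt0.
Qed.

Theorem theoremA1 (R : realType) (d : nat) (m : 'rV[R]_d) (c r : R)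
    (hm : m != 0) (hc0 : 0 < c) (hc1 : c <= 1)
    (hr0 : 0 < r) (hr : r < c * norm2 m) :
  ((2 <= d)%N ->
    is_minimum (dominating_scalings m r c)
      (c * (norm2 m ^+ 2 - r ^+ 2) / (norm2 m * (c * norm2 m - r)))) /\
  (d = 1%N ->
    is_minimum (dominating_scalings m r c) (1 + r / norm2 m) /\
    1 + r / norm2 m <=
      c * (norm2 m ^+ 2 - r ^+ 2) / (norm2 m * (c * norm2 m - r))).
Proof.
split=> [d2|d1].
  by split; [exact: alpha_dominating|exact: alpha_lbound].
split; last exact: alpha_ge.
by subst d; exact: dim1_is_minimum.
Qed.
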